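(* Let $G$ be a bounded graph with edge-perturbed twin subgraphs $X_1$ and $X_2$ (with bijection $f:V(X_1)\to V(X_2)$ and associated automorphism $\hat f$), and write $A=A(G)$. Let $\Pi$ be a partition of $V(G)$ into finite cells such that $\{a,\hat f(a)\}$ is a cell for each $a\in V(X_1)$. Let $Q=[\mathcal{B}~~\mathcal{C}]$, where the columns of $\mathcal{B}$ are the vectors $\frac{1}{\sqrt2}(\mathbf e_a-\mathbf e_{\hat f(a)})$, $a\in V(X_1)$, and $\mathcal{C}$ is the normalized characteristic matrix of $\Pi$. The following are equivalent: (1) $\Pi$ is equitable; (2) the column space of $Q$ is $A$-invariant; (3) there is a matrix $B$ such that $AQ=QB$; (4) $A$ commutes with $QQ^T$, where $QQ^T$ is the identity on the coordinates indexed by $V(X_1)\cup V(X_2)$ direct sum $\bigoplus_{k}\frac{1}{|V_k|}J_{|V_k|}$ over the remaining cells $V_k$ of $\Pi$. Moreover, if such a matrix $B$ exists, then $$B=\begin{bmatrix} A(X_1)-A' & \mathbf 0\\ \mathbf 0 & A(G/\Pi)\end{bmatrix}.$$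
   Context: A graph $G$ has a countable vertex set $V(G)$ and a symmetric weight function $w:V(G)\times V(G)\to\mathbb R$ with $w(a,b)\neq 0$ iff $\{a,b\}$ is an edge (no loops). $G$ is locally finite if $\sum_b|w(a,b)|^2<\infty$ for every $a$, and bounded if it is locally finite and the absolute degrees $\sum_b |w(a,b)|$ are uniformly bounded over $a$; then the adjacency matrix $A(G)$, $A(G)_{a,b}=w(a,b)$, is a bounded operator on $\ell^2(V(G))$. $\mathbf e_a$ is the standard basis vector of vertex $a$, and $J_k$ is the $k\times k$ all-ones matrix. Twin subgraphs: $G$ is connected, $X_1,X_2$ are vertex-disjoint induced subgraphs of $G$, and $f:V(X_1)\to V(X_2)$ is a bijection with $w(f(a),f(b))=w(a,b)$ for all $a,b\in V(X_1)$ and $w(f(a),y)=w(a,y)$ for all $a\in V(X_1)$ and $y\in V(G)\setminus(V(X_1)\cup V(X_2))$; if moreover there are no edges between $X_1$ and $X_2$ they are twin subgraphs. Edge-perturbed twin subgraphs: the same, except that edges between $X_1$ and $X_2$ are allowed provided $w(a,f(b))=w(f(a),b)$ for all $a,b\in V(X_1)$. $\hat f$ is the automorphism of $G$ exchanging $a$ and $f(a)$ for each $a\in V(X_1)$ and fixing all other vertices. $A'$ is the symmetric matrix indexed by $V(X_1)$ with $(A')_{u,v}=w(u,f(v))$ (the weights of edges between $X_1$ and $X_2$; $A'=0$ for twin subgraphs). A partition $\Pi=\bigcup_j V_j$ of $V(G)$ into finite cells has normalized characteristic matrix $\mathcal C$ whose $j$-th column is $|V_j|^{-1/2}$ times the characteristic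 vector of $V_j$. $\Pi$ is equitable if for all $j,k$ the sum $\sum_{b\in V_k}w(a,b)$ equals a constant $c_{jk}$ independent of $a\in V_j$. The quotient graph $G/\Pi$ has adjacency matrix $A(G/\Pi)_{j,k}=\sqrt{c_{jk}c_{kj}}$ if $c_{jk}\ge 0$ and $-\sqrt{c_{jk}c_{kj}}$ if $c_{jk}<0$. *)

(* Defs.v *)
From HB Require Import structures.
From mathcomp Require Import all_boot all_order all_algebra finmap.
From mathcomp Require Import all_classical all_reals.
From mathcomp Require Import ereal numfun esum.
Set Implicit Arguments.
Unset Strict Implicit.
Unset Printing Implicit Defensive.
Import Order.TTheory GRing.Theory Num.Theory.
Local Open Scope classical_set_scope.
Local Open Scope ring_scope.

(* Matrices and vectors over arbitrary, possibly infinite, index types are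
   plain functions I -> K -> R and I -> R. *)
Section Infinite_matrices.
Context {R : realType}.

(* Sum of an absolutely summable real family, as the difference of the sums of
   its positive and negative parts; it is the usual sum when the support is
   finite, and is only meaningful for absolutely summable families. *)
Definition isum (I : choiceType) (x : I -> R) : R :=
  fine (\esum_(i in [set: I]) (EFin \o x)^\+%E i
        - \esum_(i in [set: I]) (EFin \o x)^\-%E i)%E.

Definition in_ell2 (I : choiceType) (x : I -> R) : Prop :=
  (\esum_(i in [set: I]) (`|x i| ^+ 2)%:E < +oo)%E.

Definition imul (I K : Type) (J : choiceType)
    (A : I -> J -> R) (B : J -> K -> R) : I -> K -> R :=
  fun i k => isum (fun j => A i j * B j k).

Definition iapp (I : Type) (J : choiceType) (A : I -> J -> R) (x : J -> R) :
    I -> R :=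
  fun i => isum (fun j => A i j * x j).

Definition itr (I K : Type) (A : I -> K -> R) : K -> I -> R := fun k i => A i k.

Definition row_imx (I K L : Type) (A : I -> K -> R) (B : I -> L -> R) :
    I -> K + L -> R :=
  fun i c => match c with inl k => A i k | inr l => B i l end.

Definition block_imx (I I' K K' : Type) (Aul : I -> K -> R) (Aur : I -> K' -> R)
    (Adl : I' -> K -> R) (Adr : I' -> K' -> R) : I + I' -> K + K' -> R :=
  fun r c => match r, c with
  | inl i, inl k => Aul i k
  | inl i, inr k => Aur i k
  | inr i, inl k => Adl i k
  | inr i, inr k => Adr i k
  end.

(* The column space is taken in l^2: it is the range of the operator on l^2
   given by the matrix, not just the set of finite combinations of columns. *)
Definition colspace (I : Type) (K : choiceType) (Q : I -> K -> R) :
    set (I -> R) :=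
  [set y | exists2 x : K -> R, in_ell2 x & y = iapp Q x].

Definition invariant_under (I : choiceType) (A : I -> I -> R)
    (S : set (I -> R)) : Prop :=
  forall y, S y -> S (iapp A y).

Definition basis_vec (I : eqType) (a : I) : I -> R := fun b => (b == a)%:R.

End Infinite_matrices.

(* {a, b} is an edge iff weight a b != 0. *)
Record wgraph (R : realType) (V : countType) := WGraph {
  weight : V -> V -> R ;
  weight_sym : forall a b, weight a b = weight b a ;
  weight_loopless : forall a, weight a a = 0
}.

Section Graphs.
Context {R : realType}.

Definition adjmx (V : countType) (G : wgraph R V) : V -> V -> R := weight G.

Definition locally_finite (V : countType) (G : wgraph R V) : Prop :=
  forall a, in_ell2 (weight G a).

Definition bounded_graph (V : countType) (G : wgraph R V) : Prop :=
  locally_finite G /\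
  exists M : R, forall a,
    (\esum_(b in [set: V]) `|weight G a b|%:E <= M%:E)%E.

Definition edge (V : countType) (G : wgraph R V) : rel V :=
  [rel a b | weight G a b != 0].

Definition connected_graph (V : countType) (G : wgraph R V) : Prop :=
  forall a b, exists2 p : seq V, path (edge G) a p & last a p = b.

Definition induced (V : countType) (G : wgraph R V) (X : set V) : wgraph R X :=
  WGraph (fun a b : X => weight_sym G (val a) (val b))
         (fun a : X => weight_loopless G (val a)).

End Graphs.

Section Twins.
Context {R : realType} {V : countType}.
Variables (G : wgraph R V) (X1 X2 : set V) (f : V -> V).

(* Only the values of f on X1 matter. *)
Definition edge_perturbed_twins : Prop :=
  [/\ connected_graph G, X1 `&` X2 = set0 & set_bij X1 X2 f] /\
  [/\ forall a b, X1 a -> X1 b -> weight G (f a) (f b) = weight G a b,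
      forall a y, X1 a -> ~ (X1 `|` X2) y -> weight G (f a) y = weight G a y &
      forall a b, X1 a -> X1 b -> weight G a (f b) = weight G (f a) b].

Definition twin_aut (a : V) : V :=
  if a \in X1 then f a else if a \in X2 then 'pinv_id X1 f a else a.

Definition cross_mx : X1 -> X1 -> R :=
  fun u v => weight G (val u) (f (val v)).

Definition antisym_mx : V -> X1 -> R :=
  fun x a => (Num.sqrt 2)^-1 *
             (basis_vec (val a) x - basis_vec (twin_aut (val a)) x).

End Twins.

Section Partitions.
Context {R : realType} {V : countType} {J : choiceType}.
Variables (G : wgraph R V) (Pi : J -> set V).

Definition cell_card (j : J) : nat := #|` fset_set (Pi j)|.

Definition finite_cell_partition : Prop :=
  partition [set: J] Pi [set: V] /\ forall j, finite_set (Pi j).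

Definition norm_char_mx : V -> J -> R :=
  fun x j => (Num.sqrt (cell_card j)%:R)^-1 * (x \in Pi j)%:R.

Definition cell_degree (j k : J) : set R :=
  [set c | forall a, Pi j a -> \sum_(b \in Pi k) weight G a b = c].

Definition equitable : Prop := forall j k, cell_degree j k !=set0.

(* The constant c_jk, unique because cells are nonempty (0 if there is none). *)
Definition quotient_coef (j k : J) : R := xget 0 (cell_degree j k).

Definition quotient_mx : J -> J -> R := fun j k =>
  let c := quotient_coef in
  if 0 <= c j k then Num.sqrt (c j k * c k j) else - Num.sqrt (c j k * c k j).

(* Identity on the coordinates in X, direct sum |V_k|^-1 J over the cells V_k
   outside X, for X a union of cells; the last sum has at most one term, the
   cell containing both u and v. *)
Definition id_oplus_avg_mx (X : set V) : V -> V -> R := fun u v =>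
  if u \in X then (u == v)%:R
  else \sum_(k \in [set k | Pi k u /\ Pi k v]) ((cell_card k)%:R^-1 : R).

End Partitions.

(* When Pi is a partition into finite cells, every row and column of Q has
   finite support: the products A Q, Q B, Q Q^T, A (Q Q^T), (Q Q^T) A are finite
   sums for arbitrary A and B. *)
Definition Q_mx {R : realType} {V : countType} {J : choiceType}
    (X1 X2 : set V) (f : V -> V) (Pi : J -> set V) : V -> X1 + J -> R :=
  row_imx (antisym_mx X2 f) (norm_char_mx Pi).
Arguments Q_mx {R V J} X1 X2 f Pi _ _.

(* Main.v *)
(** The twin automorphism [s] is a weight-preserving involution which maps every
cell of [Pi] to itself, so cell degrees always agree at [a] and [s a]; hence
equitability only has to be tested on cells outside [X1 `|` X2], all of whose
vertices are fixed by [s].  The columns of [Q] are orthonormal, and [Q Q^T] is the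
projection onto the vectors that are constant on each cell outside [X1 `|` X2].
Each of the other three conditions is compared with equitability: a bounded [A]
preserves that space of l^2 vectors (Schur test) when [Pi] is equitable;
invariance applied to single columns of [Q] gives the columns of [B]; [A Q = Q B]
and commutation with [Q Q^T] are read off entrywise.  If [A Q = Q B], then
[B = Q^T A Q], whose entries are computed directly. *)
Require Import Defs.
From mathcomp Require Import all_boot all_order all_algebra finmap.
From mathcomp Require Import all_classical all_reals.
From mathcomp Require Import ereal numfun esum.
From mathcomp Require Import ring lra.
Set Implicit Arguments.
Unset Strict Implicit.
Unset Printing Implicit Defensive.
Import Order.TTheory GRing.Theory Num.Theory.
Local Open Scope classical_set_scope.
Local Open Scope ring_scope.

(** * Sums of real families over arbitrary index types *)

Section Real_families.
Context {R : realType}.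
Implicit Types (I K : choiceType).

Lemma le_sum_esum I (s : seq I) (a : I -> R) : uniq s -> (forall i, 0 <= a i) ->
  ((\sum_(i <- s) a i)%:E <= \esum_(i in [set: I]) (a i)%:E)%E.
Proof.
move=> us a0; apply: esum_ge; exists [set` s]; first by split.
by rewrite fsumEFin// -fsbig_seq.
Qed.

Lemma esum_seq I (s : seq I) (a : I -> R) : uniq s -> (forall i, 0 <= a i) ->
    (forall i, i \notin s -> a i = 0) ->
  (\esum_(i in [set: I]) (a i)%:E = (\sum_(i <- s) a i)%:E)%E.
Proof.
move=> us a0 sa.
have -> : (\esum_(i in [set: I]) (a i)%:E = \esum_(i in [set` s]) (a i)%:E)%E.
  rewrite [RHS]esum_mkcond; apply: eq_esum => i _.
  by case: ifPn => //; rewrite mem_setE => /sa ->.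
rewrite esum_fset// => [|i _]; last by rewrite lee_fin.
by rewrite fsumEFin// -fsbig_seq.
Qed.

Lemma esumZ_le I (c : R) (a : I -> R) : 0 <= c -> (forall i, 0 <= a i) ->
  (\esum_(i in [set: I]) (c * a i)%:E <= c%:E * \esum_(i in [set: I]) (a i)%:E)%E.
Proof.
move=> c0 a0; apply: ge_ereal_sup => _ [X [finX XI] <-].
under eq_fsbigr => i _ do rewrite EFinM.
rewrite -ge0_mule_fsumr => [|i]; last by rewrite lee_fin.
apply: lee_wpmul2l; first by rewrite lee_fin.
by apply: esum_ge; exists X.
Qed.

Lemma isum_seq I (s : seq I) (x : I -> R) : uniq s ->
  (forall i, i \notin s -> x i = 0) -> isum x = \sum_(i <- s) x i.
Proof.
move=> us sx; rewrite /isum.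
have e1 i : (EFin \o x)^\+%E i = (Num.max (x i) 0)%:E.
  by rewrite funeposE/= EFin_max.
have e2 i : (EFin \o x)^\-%E i = (Num.max (- x i) 0)%:E.
  by rewrite funenegE/= EFin_max EFinN.
rewrite (eq_esum (fun i _ => e1 i)) (eq_esum (fun i _ => e2 i)).
rewrite (esum_seq us) => [|i|i /sx ->]; last by rewrite maxxx.
  rewrite (esum_seq us) => [|i|i /sx ->]; last by rewrite oppr0 maxxx.
    rewrite -EFinB/= -sumrB; apply: eq_bigr => i _.
    by case: (leP (x i) 0) => ?; case: (leP (- x i) 0) => ?; lra.
  by rewrite le_max lexx orbT.
by rewrite le_max lexx orbT.
Qed.

Definition summableR I (x : I -> R) :=
  (\esum_(i in [set: I]) `|x i|%:E < +oo)%E.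

Lemma esum_fin_num I (p : I -> R) : (forall i, 0 <= p i) -> summableR p ->
  (\esum_(i in [set: I]) (p i)%:E)%E \is a fin_num.
Proof.
move=> p0 sp; rewrite ge0_fin_numE; last by apply: esum_ge0 => i _; rewrite lee_fin.
by under eq_esum => i _ do rewrite -(ger0_norm (p0 i)).
Qed.

(** The families [p] and [n] may overlap, so they need not be the positive and negative parts used
    in [isum]; finiteness of both sums makes the difference independent of the splitting. *)
Lemma isum_subE I (p n : I -> R) :
    (forall i, 0 <= p i) -> (forall i, 0 <= n i) -> summableR p -> summableR n ->
  isum (fun i => p i - n i) = fine (\esum_(i in [set: I]) (p i)%:E)
     - fine (\esum_(i in [set: I]) (n i)%:E).
Proof.
move=> p0 n0 sp sn; rewrite -fineB ?esum_fin_num// /isum.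
rewrite -(@esumB _ _ [set: I] (EFin \o p) (EFin \o n))//.
- by move=> i _; rewrite /= lee_fin.
- by move=> i _; rewrite /= lee_fin.
Qed.

Lemma summableRD I (x y : I -> R) :
  summableR x -> summableR y -> summableR (fun i => x i + y i).
Proof. exact: (@summableD _ _ [set: I] (EFin \o x) (EFin \o y)). Qed.

Lemma summableR_le I (x y : I -> R) :
  (forall i, `|x i| <= `|y i|) -> summableR y -> summableR x.
Proof. by move=> xy; apply: le_lt_trans; apply: le_esum => i _; rewrite lee_fin. Qed.

(** Controlling [x] and its absolute value by the same two nonnegative families reduces statements
    on signed sums to additivity of [esum]. *)
Lemma summableR_posneg I (x : I -> R) : summableR x ->
  exists p n : I -> R, [/\ forall i, 0 <= p i, forall i, 0 <= n i,
    summableR p, summableR n & forall i, x i = p i - n i /\ `|x i| = p i + n i].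
Proof.
move=> sx; exists (fun i => (`|x i| + x i) / 2), (fun i => (`|x i| - x i) / 2).
have p0 i : 0 <= (`|x i| + x i) / 2.
  by have := ler_norm (- x i); rewrite normrN; lra.
have n0 i : 0 <= (`|x i| - x i) / 2 by have := ler_norm (x i); lra.
split=> //; last by move=> i; split; lra.
- by apply: summableR_le sx => i; rewrite ger0_norm//; have := ler_norm (x i); lra.
- apply: summableR_le sx => i; rewrite ger0_norm//.
  by have := ler_norm (- x i); rewrite normrN; lra.
Qed.

Lemma isumB I (x y : I -> R) : summableR x -> summableR y ->
  isum (fun i => x i - y i) = isum x - isum y.
Proof.
move=> /summableR_posneg[px [nx [px0 nx0 spx snx xE]]].
move=> /summableR_posneg[py [ny [py0 ny0 spy sny yE]]].
have -> : x = fun i => px i - nx i by apply/funext => i; case: (xE i).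
have -> : y = fun i => py i - ny i by apply/funext => i; case: (yE i).
have add p q : (forall i, 0 <= p i) -> summableR p ->
    (forall i, 0 <= q i) -> summableR q ->
    fine (\esum_(i in [set: I]) (p i + q i)%:E)%E =
    fine (\esum_(i in [set: I]) (p i)%:E)%E + fine (\esum_(i in [set: I]) (q i)%:E)%E.
  move=> p0 sp q0 sq; rewrite -fineD ?esum_fin_num//; congr fine.
  by rewrite -esumD// => i _; rewrite lee_fin.
(* Regrouped as a difference of two nonnegative summable families, the sum falls under
   [isum_subE]. *)
have -> : isum (fun i => px i - nx i - (py i - ny i)) =
    isum (fun i => (px i + ny i) - (nx i + py i)).
  by congr isum; apply/funext => i; ring.
rewrite (isum_subE px0 nx0 spx snx) (isum_subE py0 ny0 spy sny) isum_subE.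
- by rewrite (add _ _ px0 spx ny0 sny) (add _ _ nx0 snx py0 spy); ring.
- by move=> i; rewrite addr_ge0.
- by move=> i; rewrite addr_ge0.
- exact: summableRD spx sny.
- exact: summableRD snx spy.
Qed.

(** * Membership in l^2 and the estimates of the Schur test *)

Lemma exchange_esum I K (k : I -> K -> R) : (forall i j, 0 <= k i j) ->
  (\esum_(i in [set: I]) \esum_(j in [set: K]) (k i j)%:E =
   \esum_(j in [set: K]) \esum_(i in [set: I]) (k i j)%:E)%E.
Proof.
move=> k0; rewrite !esum_esum; try by move=> *; rewrite lee_fin.
rewrite (reindex_esum ([set: K] `*`` fun=> [set: I]) _ (fun x => (x.2, x.1)))//.
split=> //= [[i j] [i' j'] _ _ [-> ->]//|[i j] _].
by exists (j, i).
Qed.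

(** Summing the row estimates and exchanging the two sums bounds the squared norm of [y] by [C]
    times that of [x]. The operators of [Q], of its transpose and of the adjacency matrix are all
    treated this way, each with its own kernel [k]. *)
Lemma in_ell2_dominated I K (k : K -> I -> R) (C : R) (x : I -> R) (y : K -> R) :
    (forall v c, 0 <= k v c) -> 0 <= C -> in_ell2 x ->
    (forall v, ((y v ^+ 2)%:E <= \esum_(c in [set: I]) (k v c * x c ^+ 2)%:E)%E) ->
    (forall c, (\esum_(v in [set: K]) (k v c)%:E <= C%:E)%E) ->
  in_ell2 y.
Proof.
move=> k0 C0 x2 yx kC; rewrite /in_ell2.
have := lte_mul_pinfty (_ : 0 <= C%:E)%E (_ : C%:E \is a fin_num) x2.
rewrite lee_fin => /(_ C0 isT); apply: le_lt_trans.
apply: le_trans (_ : \esum_(v in [set: K]) \esum_(c in [set: I])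
    (k v c * x c ^+ 2)%:E <= _)%E.
  by apply: le_esum => v _; rewrite real_normK ?num_real//.
rewrite exchange_esum; last by move=> v c; rewrite mulr_ge0 ?sqr_ge0.
apply: le_trans (_ : \esum_(c in [set: I]) (C * `|x c| ^+ 2)%:E <= _)%E; last first.
  by apply: esumZ_le => // i; rewrite sqr_ge0.
apply: le_esum => c _; rewrite real_normK ?num_real//.
under eq_esum => v _ do rewrite mulrC.
apply: le_trans (esumZ_le (sqr_ge0 _) (fun v => k0 v c)) _.
rewrite [leRHS](_ : _ = (x c ^+ 2)%:E * C%:E)%E; last by rewrite -EFinM mulrC.
apply: lee_wpmul2l; last exact: kC.
by rewrite lee_fin sqr_ge0.
Qed.

Lemma norm_isum_le I (x : I -> R) : summableR x ->
  `|isum x| <= fine (\esum_(i in [set: I]) `|x i|%:E)%E.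
Proof.
move=> /summableR_posneg[p [n [p0 n0 sp sn xE]]].
have -> : x = fun i => p i - n i by apply/funext => i; case: (xE i).
have -> : (\esum_(i in [set: I]) `|p i - n i|%:E =
   \esum_(i in [set: I]) (p i)%:E + \esum_(i in [set: I]) (n i)%:E)%E.
  rewrite -esumD; try by move=> *; rewrite lee_fin.
  by apply: eq_esum => i _; case: (xE i) => <- ->.
rewrite isum_subE// fineD ?esum_fin_num//.
have P0 (q : I -> R) : (forall i, 0 <= q i) ->
    0 <= fine (\esum_(i in [set: I]) (q i)%:E)%E.
  by move=> q0; apply: fine_ge0; apply: esum_ge0 => i _; rewrite lee_fin.
by rewrite ler_norml; have := P0 _ p0; have := P0 _ n0; lra.
Qed.

Section Weighted.
Variables (I : choiceType) (w y : I -> R) (M : R).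
Hypotheses (M0 : 0 < M) (wM : (\esum_(i in [set: I]) `|w i|%:E <= M%:E)%E)
  (y2 : in_ell2 y).

Let weight_sqr_ge0 i : 0 <= `|w i| * y i ^+ 2.
Proof. by apply: mulr_ge0 => //; exact: sqr_ge0. Qed.

Lemma summable_weight_sqr : summableR (fun i => `|w i| * y i ^+ 2).
Proof.
have := lte_mul_pinfty (_ : 0 <= M%:E)%E (_ : M%:E \is a fin_num) y2.
rewrite lee_fin => /(_ (ltW M0) isT); apply: le_lt_trans.
apply: le_trans (esumZ_le (ltW M0) _) => [|i]; last exact: sqr_ge0.
apply: le_esum => i _; rewrite lee_fin ger0_norm//.
rewrite real_normK ?num_real// ler_wpM2r ?sqr_ge0//.
(* A single weight is one term of the sum bounded by [M]. *)
rewrite -lee_fin; apply: le_trans wM.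
have := le_sum_esum (s := [:: i]) (a := fun i => `|w i|).
by rewrite big_seq1; apply.
Qed.

(** It follows from [|y| <= 1 + y^2], multiplied by [|w|]. *)
Lemma summable_weight_mul : summableR (fun i => w i * y i).
Proof.
have sw : summableR w by apply: le_lt_trans wM _; rewrite ltry.
apply: summableR_le (summableRD (_ : summableR (fun i => `|w i|)) summable_weight_sqr).
  move=> i; rewrite normrM [leRHS]ger0_norm ?addr_ge0//.
  rewrite -[y i ^+ 2]real_normK ?num_real// -[X in X + _]mulr1 -mulrDr.
  by rewrite ler_wpM2l//; have := normr_ge0 (y i); nra.
by apply: summableR_le sw => i; rewrite normr_id.
Qed.

(** This is Cauchy-Schwarz for the measure with density [|w|], whose total mass is at most [M]. *)
Lemma isum_weight_sqr : isum (fun i => w i * y i) ^+ 2 <=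
  M * fine (\esum_(i in [set: I]) (`|w i| * y i ^+ 2)%:E)%E.
Proof.
set T := fine _.
have s1 := summable_weight_mul; have s2 := summable_weight_sqr.
have := norm_isum_le s1; set S := fine _ => iS.
have T0 : 0 <= T.
  by apply: fine_ge0; apply: esum_ge0 => i _; rewrite lee_fin.
suff ST : S ^+ 2 <= M * T.
  apply: le_trans ST; rewrite -[leLHS]real_normK ?num_real//.
  by rewrite ler_pXn2r ?nnegrE//; apply: le_trans iS.
have fT : (\esum_(i in [set: I]) (`|w i| * y i ^+ 2)%:E)%E = T%:E.
  by rewrite fineK// esum_fin_num.
have fS : (\esum_(i in [set: I]) `|w i * y i|%:E)%E = S%:E.
  by rewrite fineK// esum_fin_num//; apply: summableR_le s1 => i; rewrite normr_id.
have : 0 <= S by apply: le_trans iS.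
(* The case [S = 0] is set apart because the parameter [t] below must be positive. *)
rewrite le_eqVlt => /predU1P[<-|S0]; first by rewrite expr0n mulr_ge0// ltW.
(* AM-GM: [|w| |y| <= t / 2 |w| + |w| y^2 / (2 t)], optimal at [t = S / M]. *)
pose t := S / M; have t0 : 0 < t by rewrite divr_gt0.
suff : S <= t / 2 * M + (2 * t)^-1 * T.
  rewrite /t.
  have -> : S / M / 2 * M = S / 2 by field; rewrite gt_eqF.
  have -> : (2 * (S / M))^-1 * T = M * T / (2 * S) by field; rewrite !gt_eqF.
  move=> h; have : S / 2 <= M * T / (2 * S) by lra.
  by rewrite ler_pdivlMr ?mulr_gt0//; lra.
rewrite -lee_fin -fS EFinD !EFinM -fT.
apply: le_trans (_ : \esum_(i in [set: I])
   ((t / 2 * `|w i|)%:E + ((2 * t)^-1 * (`|w i| * y i ^+ 2))%:E) <= _)%E.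
  apply: le_esum => i _; rewrite -EFinD lee_fin normrM.
  have -> : t / 2 * `|w i| + (2 * t)^-1 * (`|w i| * y i ^+ 2) =
      `|w i| * `|y i| + (2 * t)^-1 * `|w i| * (t - `|y i|) ^+ 2.
    by rewrite -[y i ^+ 2]real_normK ?num_real//; field; rewrite gt_eqF.
  by rewrite lerDl mulr_ge0 ?sqr_ge0// mulr_ge0// invr_ge0; lra.
rewrite esumD; last 2 first.
- by move=> i _; rewrite lee_fin mulr_ge0//; lra.
- by move=> i _; rewrite lee_fin mulr_ge0// invr_ge0; lra.
apply: leeD.
  apply: le_trans (esumZ_le _ _) _ => //; first by lra.
  by rewrite -EFinM; apply: lee_wpmul2l => //; rewrite lee_fin; lra.
apply: esumZ_le; first by rewrite invr_ge0; lra.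
exact: weight_sqr_ge0.
Qed.

End Weighted.

(* [esum_bigcupT] only covers families of sets indexed by [nat]. *)
Lemma esum_cells I K (F : K -> set I) (a : I -> \bar R) :
    trivIset [set: K] F -> \bigcup_k F k = [set: I] -> (forall i, 0 <= a i)%E ->
  (\esum_(i in [set: I]) a i = \esum_(k in [set: K]) \esum_(i in F k) a i)%E.
Proof.
move=> trivF covF a0; rewrite esum_esum//; apply: reindex_esum; split=> //.
- move=> [k i] [k' i']; rewrite !inE/= => -[_ Fki] [_ Fki'] ei; subst i'.
  by rewrite (trivF k k')//; exists i.
- move=> i _; have : [set: I] i by []. rewrite -covF => -[k _ Fki].
  by exists (k, i).
Qed.

(** On each finite cell the positive and negative parts have equal sums, hence they have equal
    totals. *)
Lemma isum_cells0 I K (F : K -> set I) (x : I -> R) :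
    trivIset [set: K] F -> \bigcup_k F k = [set: I] ->
    (forall k, finite_set (F k)) ->
    (forall k, \sum_(i \in F k) x i = 0) ->
  isum x = 0.
Proof.
move=> trivF covF finF x0; rewrite /isum.
suff -> : (\esum_(i in [set: I]) (EFin \o x)^\+%E i =
           \esum_(i in [set: I]) (EFin \o x)^\-%E i)%E.
  (* If the common total is infinite, the difference is infinite too and [fine] sends it to 0. *)
  by case: (\esum_(i in _) _)%E => //= r; rewrite subrr.
rewrite !(esum_cells trivF covF)//.
apply: eq_esum => k _; rewrite !esum_fset//.
have e1 i : (EFin \o x)^\+%E i = (Num.max (x i) 0)%:E.
  by rewrite funeposE/= EFin_max.
have e2 i : (EFin \o x)^\-%E i = (Num.max (- x i) 0)%:E.
  by rewrite funenegE/= EFin_max EFinN.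
under eq_fsbigr do rewrite e1.
under [RHS]eq_fsbigr do rewrite e2.
rewrite !fsumEFin//; congr EFin; apply/eqP; rewrite -subr_eq0; apply/eqP.
rewrite -[RHS](x0 k) !fsbig_finite//= -sumrB; apply: eq_bigr => i _.
by case: (leP (x i) 0) => ?; case: (leP (- x i) 0) => ?; lra.
Qed.

End Real_families.

(** * The twin automorphism *)

Section Twins.
Context {R : realType} {V : countType} {G : wgraph R V} {X1 X2 : set V} {f : V -> V}.
Hypothesis tw : edge_perturbed_twins G X1 X2 f.
Local Notation s := (twin_aut X1 X2 f).
Local Notation w := (weight G).

Lemma twins_disjoint a : X1 a -> ~ X2 a.
Proof. by case: tw => -[_ X12 _] _ X1a X2a; have : (X1 `&` X2) a by []; rewrite X12. Qed.

Lemma twins_codom a : X1 a -> X2 (f a).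
Proof. by case: tw => -[_ _ [ff _ _]] _; exact: ff. Qed.

Lemma twin_autL a : X1 a -> s a = f a.
Proof. by move=> X1a; rewrite /twin_aut mem_set. Qed.

Lemma twin_autR a : X1 a -> s (f a) = a.
Proof.
move=> X1a; have X2fa := twins_codom X1a.
rewrite /twin_aut memNset; last by move=> /twins_disjoint.
rewrite mem_set// pinvKV ?mem_set//.
by case: tw => -[_ _ [_ finj _]] _.
Qed.

Lemma twin_aut_out a : ~ (X1 `|` X2) a -> s a = a.
Proof. by move=> Xa; rewrite /twin_aut !memNset// => ?; apply: Xa; [right|left]. Qed.

(** A vertex of [X2] is presented as the image of a vertex of [X1], so that later arguments only use
    the hypotheses on [X1]. *)
Lemma twins_cases b :
  [\/ X1 b, exists2 a, X1 a & b = s a | ~ (X1 `|` X2) b].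
Proof.
have [X1b|X1b] := pselect (X1 b); first by constructor 1.
have [X2b|X2b] := pselect (X2 b); last by constructor 3; case.
constructor 2; case: tw => -[_ _ [_ _ fsurj]] _.
by have [a X1a <-] := fsurj b X2b; exists a => //; rewrite twin_autL.
Qed.

Lemma twin_autX a : X1 a -> X2 (s a).
Proof. by move=> X1a; rewrite twin_autL//; exact: twins_codom. Qed.

Lemma twin_aut_X1K a : X1 a -> s (s a) = a.
Proof. by move=> X1a; rewrite (twin_autL X1a) twin_autR. Qed.

Lemma twin_autK : involutive s.
Proof.
move=> b; case: (twins_cases b) => [|[a X1a ->]|Xb]; first exact: twin_aut_X1K.
  by rewrite (twin_aut_X1K X1a).
by rewrite !twin_aut_out.
Qed.

Lemma twin_aut_neq a : X1 a -> (s a == a) = false.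
Proof.
by move=> X1a; apply/eqP => sa; apply: (twins_disjoint X1a);
  rewrite -sa; exact: twin_autX.
Qed.

Lemma weight_twin_aut u v : w (s u) (s v) = w u v.
Proof.
case: tw => _ [wff wfy wx].
(* With one argument in [X1], the three weight conditions match the three positions of the other
   argument. The remaining cases reduce to this one by symmetry of the weights and [twin_autK], or
   have both vertices fixed. *)
have twX1 a b : X1 a -> w (s a) (s b) = w a b.
  move=> X1a; rewrite (twin_autL X1a).
  case: (twins_cases b) => [X1b|[c X1c ->]|Xb].
  - by rewrite (twin_autL X1b) wff.
  - by rewrite twin_aut_X1K// (twin_autL X1c) wx.
  - by rewrite twin_aut_out// wfy.
case: (twins_cases u) => [X1u|[c X1c ->]|Xu]; first exact: twX1.
  by rewrite twin_aut_X1K// -(twX1 c) // twin_autK.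
case: (twins_cases v) => [X1v|[c X1c ->]|Xv]; rewrite (twin_aut_out Xu).
- by rewrite ![w u _]weight_sym -(twX1 v u X1v) (twin_aut_out Xu).
- by rewrite twin_aut_X1K// ![w u _]weight_sym -(twX1 c u X1c) (twin_aut_out Xu).
- by rewrite twin_aut_out.
Qed.

Lemma weight_twin_out u v : ~ (X1 `|` X2) u -> w u (s v) = w u v.
Proof. by move=> Xu; rewrite -[RHS]weight_twin_aut (twin_aut_out Xu). Qed.

(** * Cells and cell degrees *)

Section Cells.
Context {J : choiceType} {Pi : J -> set V}.
Hypothesis fP : finite_cell_partition Pi.
Hypothesis pairs : forall a, X1 a -> exists j, Pi j = [set a; s a].

Lemma cell_exists v : exists j, Pi j v.
Proof.
case: fP => -[cov _ _] _; have : [set: V] v by [].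
by rewrite -cov => -[j _ Pjv]; exists j.
Qed.

Definition cell_of v : J := sval (cid (cell_exists v)).

Lemma cell_ofP v : Pi (cell_of v) v.
Proof. exact: (svalP (cid (cell_exists v))). Qed.

Lemma cell_ofE j v : Pi j v -> cell_of v = j.
Proof.
case: fP => -[_ triv _] _ Pjv; apply: triv => //.
by exists v; split => //; exact: cell_ofP.
Qed.

Lemma in_cell j v : (v \in Pi j) = (cell_of v == j).
Proof.
apply/idP/eqP => [/set_mem/cell_ofE//|<-]; exact/mem_set/cell_ofP.
Qed.

Lemma finite_cell j : finite_set (Pi j).
Proof. by case: fP. Qed.

Lemma cell_nonempty j : exists v, Pi j v.
Proof. by case: fP => -[_ _ ne] _; exact: ne. Qed.

Lemma cell_card_gt0 j : 0 < (cell_card Pi j)%:R :> R.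
Proof.
rewrite ltr0n /cell_card lt0n cardfs_eq0; apply/eqP => P0.
have [v] := cell_nonempty j.
by rewrite (fset_set_set0 (finite_cell j) P0).
Qed.

Lemma cell_twins a : X1 a -> Pi (cell_of a) = [set a; s a].
Proof.
move=> X1a; have [j Pj] := pairs X1a.
by have /cell_ofE -> : Pi j a by rewrite Pj; left.
Qed.

Lemma cell_of_twin v : cell_of (s v) = cell_of v.
Proof.
have cX1 a : X1 a -> cell_of (s a) = cell_of a.
  by move=> X1a; apply: cell_ofE; rewrite cell_twins//; right.
case: (twins_cases v) => [|[a X1a ->]|Xv]; first exact: cX1.
  by rewrite twin_autK cX1.
by rewrite twin_aut_out.
Qed.

Lemma cell_card_twins a : X1 a -> cell_card Pi (cell_of a) = 2%N.
Proof.
move=> X1a; rewrite /cell_card cell_twins// fset_setU//.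
by rewrite !fset_set1 cardfs2 eq_sym twin_aut_neq.
Qed.

(** A cell meeting [X1] is a twin pair, and one meeting [X2] also meets [X1] because the
    automorphism preserves cells. *)
Lemma cell_cases k :
  (exists2 a, X1 a & k = cell_of a) \/ forall v, Pi k v -> ~ (X1 `|` X2) v.
Proof.
have [h|h] := pselect (exists2 a, X1 a & k = cell_of a); first by left.
right=> v /cell_ofE kv; case: (twins_cases v) => [X1v|[a X1a va]|//].
  by case: h; exists v.
by case: h; exists a => //; rewrite -cell_of_twin -va.
Qed.

Lemma same_cell_out u v : cell_of u = cell_of v -> ~ (X1 `|` X2) u ->
  ~ (X1 `|` X2) v.
Proof.
move=> uv Xu; case: (cell_cases (cell_of v)) => [[a X1a av]|];
  last by apply; exact: cell_ofP.
have : Pi (cell_of a) u by rewrite -av -uv; exact: cell_ofP.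
by rewrite cell_twins// => -[]/= ua; move: Xu; rewrite ua => /(_ _)[];
  [left|right; exact: twin_autX].
Qed.

Lemma sum_cell_twins (F : V -> R) a : X1 a ->
  \sum_(b \in Pi (cell_of a)) F b = F a + F (s a).
Proof.
move=> X1a; rewrite cell_twins// fsbigU0//= ?fsbig_set1// => x [/= -> /eqP].
by rewrite eq_sym twin_aut_neq.
Qed.

Lemma sum_cell_twin_aut (F : V -> R) k :
  \sum_(b \in Pi k) F (s b) = \sum_(b \in Pi k) F b.
Proof.
rewrite [RHS](reindex_fsbig s (Pi k))//; split=> [b|b c _ _|b] /=.
- by move=> /cell_ofE <-; rewrite -(cell_of_twin b); exact: cell_ofP.
- exact: (can_inj twin_autK).
- move=> /cell_ofE <-; exists (s b); last exact: twin_autK.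
  by rewrite /= -(cell_of_twin b); exact: cell_ofP.
Qed.

(** The automorphism permutes the cell [Pi k] and preserves weights. This makes the degree condition
    automatic on twin pairs. *)
Lemma degree_twin k u : \sum_(b \in Pi k) w (s u) b = \sum_(b \in Pi k) w u b.
Proof.
rewrite -sum_cell_twin_aut; apply: eq_fsbigr => b _; exact: weight_twin_aut.
Qed.

(** Both sides are the total weight between the two cells, which is symmetric; this leads to
    [equitable_balance]. *)
Lemma exchange_degree j k :
  \sum_(u \in Pi j) \sum_(b \in Pi k) w u b =
  \sum_(b \in Pi k) \sum_(u \in Pi j) w b u.
Proof.
rewrite exchange_fsbig//; try exact: finite_cell.
by apply: eq_fsbigr => b _; apply: eq_fsbigr => u _; exact: weight_sym.
Qed.

Lemma equitableP : equitable G Pi <-> forall k u v, cell_of u = cell_of v ->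
  \sum_(b \in Pi k) w u b = \sum_(b \in Pi k) w v b.
Proof.
split=> [eqG k u v uv|h j k].
  have [c hc] := eqG (cell_of v) k.
  by rewrite (hc v (cell_ofP v)) (hc u)// -uv; exact: cell_ofP.
have [u Pju] := cell_nonempty j; exists (\sum_(b \in Pi k) w u b) => v Pjv.
by apply: h; rewrite (cell_ofE Pju) (cell_ofE Pjv).
Qed.

Lemma equitable_outP :
  (forall k u v, cell_of u = cell_of v -> ~ (X1 `|` X2) u -> ~ (X1 `|` X2) v ->
    \sum_(b \in Pi k) w u b = \sum_(b \in Pi k) w v b) -> equitable G Pi.
Proof.
move=> h; apply/equitableP => k u v uv.
case: (cell_cases (cell_of u)) => [[a X1a ua]|Xu]; last first.
  have {}Xu := Xu _ (cell_ofP u).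
  by apply: h => //; exact: same_cell_out Xu.
have dega x : cell_of x = cell_of a ->
    \sum_(b \in Pi k) w x b = \sum_(b \in Pi k) w a b.
  move=> xa; have : Pi (cell_of a) x by rewrite -xa; exact: cell_ofP.
  by rewrite cell_twins// => -[->//|->]; exact: degree_twin.
by rewrite !dega// -uv.
Qed.

Lemma quotient_coefE k u : equitable G Pi ->
  quotient_coef G Pi (cell_of u) k = \sum_(b \in Pi k) w u b.
Proof.
move=> /equitableP h; apply: xget_unique => [v /cell_ofE uv|c].
  exact: h.
by move=> /(_ u (cell_ofP u)) <-.
Qed.

Lemma sum_cell_const (F : V -> R) k (c : R) : (forall v, Pi k v -> F v = c) ->
  \sum_(v \in Pi k) F v = (cell_card Pi k)%:R * c.
Proof.
move=> Fc; rewrite fsbig_finite//=; last exact: finite_cell.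
rewrite big_seq (eq_bigr (fun=> c)) => [|v]; last first.
  by rewrite in_fset_set ?inE; [exact: Fc|exact: finite_cell].
by rewrite -big_seq big_const_seq count_predT iter_addr_0 mulr_natl.
Qed.

(** * The matrix [Q], its transpose and their products *)

Local Notation Q := (Q_mx X1 X2 f Pi : V -> X1 + J -> R).
Local Notation A := (adjmx G).
Local Notation n j := ((cell_card Pi j)%:R : R).

Lemma X1_val (a : X1) : X1 (val a).
Proof. exact: set_mem (valP a). Qed.

(** Unlike [twins_cases], this delivers elements of the type [X1], which indexes the left columns of
    [Q]. *)
Lemma X1_caseP (Z : V -> Prop) :
  (forall a : X1, Z (val a)) -> (forall a : X1, Z (s (val a))) ->
  (forall v, ~ (X1 `|` X2) v -> Z v) -> forall v, Z v.
Proof.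
move=> Z1 Z2 Z3 v; case: (twins_cases v) => [X1v|[a X1a ->]|]; last exact: Z3.
- by have := Z1 (exist _ v (mem_set X1v)).
- by have := Z2 (exist _ a (mem_set X1a)).
Qed.

Lemma QlE v (a : X1) :
  Q v (inl a) = (Num.sqrt 2)^-1 * ((v == val a)%:R - (v == s (val a))%:R).
Proof. by []. Qed.

Lemma QrE v j : Q v (inr j) = (Num.sqrt (n j))^-1 * (cell_of v == j)%:R.
Proof. by rewrite /= /norm_char_mx in_cell. Qed.

Lemma Q_out v (a : X1) : ~ (X1 `|` X2) v -> Q v (inl a) = 0.
Proof.
move=> Xv; rewrite QlE.
have -> : (v == val a) = false.
  by apply/eqP => va; apply: Xv; left; rewrite va; exact: X1_val.
have -> : (v == s (val a)) = false.
  by apply/eqP => va; apply: Xv; right; rewrite va; exact/twin_autX/X1_val.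
by rewrite subrr mulr0.
Qed.

Lemma val_neq_twin (a b : X1) : (val a == s (val b)) = false.
Proof.
apply/eqP => ab; apply: (twins_disjoint (X1_val a)).
by rewrite ab; exact/twin_autX/X1_val.
Qed.

Lemma Q_val (a b : X1) : Q (val a) (inl b) = (Num.sqrt 2)^-1 * (b == a)%:R.
Proof. by rewrite QlE val_neq_twin subr0 val_eqE eq_sym. Qed.

Lemma Q_twin (a b : X1) : Q (s (val a)) (inl b) = - ((Num.sqrt 2)^-1 * (b == a)%:R).
Proof.
rewrite QlE eq_sym val_neq_twin sub0r mulrN (can_eq twin_autK) val_eqE.
by rewrite eq_sym.
Qed.

(** A twin pair has two elements, so its column has the same scaling as the antisymmetric
    columns. *)
Lemma QrE_twins (a : X1) v j : cell_of v = cell_of (val a) ->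
  Q v (inr j) = (Num.sqrt 2)^-1 * (cell_of (val a) == j)%:R.
Proof.
move=> va; rewrite QrE va; case: eqP => [<-|]; last by rewrite !mulr0.
by rewrite cell_card_twins//; exact: X1_val.
Qed.

(** A row of [Q] has one nonzero entry outside the twins and two at a twin, so applying [Q] needs no
    summability of [z]. *)
Lemma iapp_Q_out z v : ~ (X1 `|` X2) v ->
  iapp Q z v = (Num.sqrt (n (cell_of v)))^-1 * z (inr (cell_of v)).
Proof.
move=> Xv; rewrite /iapp (@isum_seq _ _ [:: inr (cell_of v)])// => [|[a _|j]].
- by rewrite big_seq1 QrE eqxx mulr1.
- by rewrite Q_out// mul0r.
- rewrite inE => jv; rewrite QrE; case: eqP => [e|_]; last by rewrite mulr0 mul0r.
  by rewrite e eqxx in jv.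
Qed.

Lemma iapp_Q_val z (a : X1) : iapp Q z (val a) =
  (Num.sqrt 2)^-1 * (z (inl a) + z (inr (cell_of (val a)))).
Proof.
rewrite /iapp (@isum_seq _ _ [:: inl a; inr (cell_of (val a))])// => [|[b|j]].
- by rewrite big_cons big_seq1 Q_val (QrE_twins (a:=a))// !eqxx !mulr1 mulrDr.
- rewrite !inE => /norP[ba _]; rewrite Q_val.
  by rewrite (_ : (b == a) = false) ?mulr0 ?mul0r//; apply: negbTE.
- rewrite !inE => /norP[_ ja]; rewrite (QrE_twins (a:=a))//.
  rewrite eq_sym (_ : (j == _) = false) ?mulr0 ?mul0r//; exact: negbTE.
Qed.

Lemma iapp_Q_twin z (a : X1) : iapp Q z (s (val a)) =
  (Num.sqrt 2)^-1 * (z (inr (cell_of (val a))) - z (inl a)).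
Proof.
rewrite /iapp (@isum_seq _ _ [:: inl a; inr (cell_of (val a))])// => [|[b|j]].
- rewrite big_cons big_seq1 Q_twin (QrE_twins (a:=a)) ?cell_of_twin//.
  by rewrite !eqxx !mulr1 mulrBr addrC mulNr.
- rewrite !inE => /norP[ba _]; rewrite Q_twin.
  by rewrite (_ : (b == a) = false) ?mulr0 ?oppr0 ?mul0r//; apply: negbTE.
- rewrite !inE => /norP[_ ja]; rewrite (QrE_twins (a:=a)) ?cell_of_twin//.
  rewrite eq_sym (_ : (j == _) = false) ?mulr0 ?mul0r//; exact: negbTE.
Qed.

Lemma iapp_itr_Q_l (z : V -> R) (a : X1) :
  iapp (itr Q) z (inl a) = (Num.sqrt 2)^-1 * (z (val a) - z (s (val a))).
Proof.
have sa : (s (val a) == val a) = false by rewrite twin_aut_neq//; exact: X1_val.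
rewrite /iapp /itr (@isum_seq _ _ [:: val a; s (val a)]).
- rewrite big_cons big_seq1 !QlE !eqxx sa eq_sym sa.
  by rewrite subr0 sub0r mulr1 mulrN1 mulNr mulrBr.
- by rewrite /= inE eq_sym sa.
- by move=> v; rewrite !inE => /norP[/negbTE va /negbTE vsa];
    rewrite QlE va vsa subrr mulr0 mul0r.
Qed.

Lemma iapp_itr_Q_r (z : V -> R) j :
  iapp (itr Q) z (inr j) = (Num.sqrt (n j))^-1 * \sum_(v \in Pi j) z v.
Proof.
rewrite /iapp /itr (@isum_seq _ _ (fset_set (Pi j))).
- rewrite fsbig_finite ?mulr_sumr; last exact: finite_cell.
  rewrite !big_seq; apply: eq_bigr => v; rewrite in_fset_set; last exact: finite_cell.
  by rewrite in_cell QrE => ->; rewrite mulr1.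
- exact: fset_uniq.
- move=> v; rewrite in_fset_set; last exact: finite_cell.
  by rewrite in_cell QrE => /negbTE ->; rewrite mulr0 mul0r.
Qed.

(** Reading a row of the product as the transpose of [Q] applied to a row of [B] reuses the two
    formulas above. *)
Lemma imul_QE (B : V -> V -> R) x c : imul B Q x c = iapp (itr Q) (B x) c.
Proof. by rewrite /imul /iapp /itr; congr isum; apply/funext => j; rewrite mulrC. Qed.

Lemma sqrt2V_sqr : (Num.sqrt 2 : R)^-1 * (Num.sqrt 2)^-1 = 2^-1.
Proof. by rewrite -invfM -expr2 sqr_sqrtr. Qed.

Lemma sqrt_cardV_sqr j : (Num.sqrt (n j))^-1 * (Num.sqrt (n j))^-1 = (n j)^-1.
Proof. by rewrite -invfM -expr2 sqr_sqrtr. Qed.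

(** This is orthonormality of the columns of [Q], valid for every [z] since all sums involved are
    finite. *)
Lemma itr_Q_iapp_Q z : iapp (itr Q) (iapp Q z) = z.
Proof.
apply/funext => -[a|j].
  rewrite iapp_itr_Q_l iapp_Q_val iapp_Q_twin -mulrBr mulrA sqrt2V_sqr; lra.
rewrite iapp_itr_Q_r; case: (cell_cases j) => [[v X1v ->]|Xj].
  pose a : X1 := exist _ v (mem_set X1v).
  rewrite sum_cell_twins// (iapp_Q_val z a) (iapp_Q_twin z a)/= cell_card_twins//.
  rewrite -mulrDr mulrA sqrt2V_sqr; lra.
rewrite (sum_cell_const (c := (Num.sqrt (n j))^-1 * z (inr j))); last first.
  by move=> v Pjv; rewrite iapp_Q_out ?(cell_ofE Pjv)//; exact: Xj.
rewrite mulrCA [X in _ * X]mulrA sqrt_cardV_sqr mulVKf//.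
by rewrite gt_eqF// cell_card_gt0.
Qed.

(** On a twin pair [Q] restricts to an orthogonal 2 by 2 block, so [z] is unconstrained there; on
    any other cell [Q Q^T] averages, which fixes constants. *)
Lemma iapp_Q_itr_Q (z : V -> R) :
  (forall u v, cell_of u = cell_of v -> ~ (X1 `|` X2) u -> z u = z v) ->
  iapp Q (iapp (itr Q) z) = z.
Proof.
move=> zc; apply/funext; apply: X1_caseP => [a|a|v Xv].
- rewrite iapp_Q_val iapp_itr_Q_l iapp_itr_Q_r cell_card_twins; last exact: X1_val.
  rewrite sum_cell_twins; last exact: X1_val.
  by rewrite -mulrDr mulrA sqrt2V_sqr; lra.
- rewrite iapp_Q_twin iapp_itr_Q_l iapp_itr_Q_r cell_card_twins; last exact: X1_val.
  rewrite sum_cell_twins; last exact: X1_val.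
  by rewrite -mulrBr mulrA sqrt2V_sqr; lra.
- rewrite iapp_Q_out// iapp_itr_Q_r mulrA sqrt_cardV_sqr.
  rewrite (sum_cell_const (c := z v)) ?mulKf// ?gt_eqF ?cell_card_gt0//.
  by move=> u /cell_ofE uv; rewrite (zc v u).
Qed.

Lemma imul_Q_itr_QE :
  imul Q (itr Q) = id_oplus_avg_mx Pi (X1 `|` X2).
Proof.
apply/funext => u; apply/funext => v; rewrite /id_oplus_avg_mx.
(* Entry [(u, v)] of [Q Q^T] is [Q] applied to row [v] of [Q], evaluated at [u]. *)
rewrite -[LHS]/(iapp Q (Q v) u); move: u; apply: X1_caseP => [a|a|u Xu].
- rewrite mem_set; last by left; exact: X1_val.
  rewrite iapp_Q_val QrE QlE cell_card_twins; last exact: X1_val.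
  rewrite -mulrDr mulrA sqrt2V_sqr -in_cell cell_twins; last exact: X1_val.
  have -> : (v \in [set val a; s (val a)]) = (v == val a) || (v == s (val a)).
    by rewrite in_setU !in_set1.
  rewrite [val a == v]eq_sym; case: (eqVneq v (val a)) => [->|_].
    by rewrite val_neq_twin /=; lra.
  by case: eqP => _ /=; lra.
- rewrite mem_set; last by right; exact/twin_autX/X1_val.
  rewrite iapp_Q_twin QrE QlE cell_card_twins; last exact: X1_val.
  rewrite -mulrBr mulrA sqrt2V_sqr -in_cell cell_twins; last exact: X1_val.
  have -> : (v \in [set val a; s (val a)]) = (v == val a) || (v == s (val a)).
    by rewrite in_setU !in_set1.
  rewrite [s _ == v]eq_sym; case: (eqVneq v (s (val a))) => [->|_].
    by rewrite eq_sym val_neq_twin /=; lra.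
  by case: eqP => _ /=; lra.
- rewrite memNset// iapp_Q_out// QrE mulrA sqrt_cardV_sqr.
  case: eqP => [vu|vu].
    rewrite (_ : [set k | _] = [set cell_of u]) ?fsbig_set1 ?mulr1//.
    apply/seteqP; split=> [k [/cell_ofE <-]//|_ ->] /=.
    by split; [exact: cell_ofP|rewrite -vu; exact: cell_ofP].
  rewrite (_ : [set k | _] = set0) ?fsbig_set0 ?mulr0//.
  by apply/seteqP; split=> // k [/cell_ofE uk /cell_ofE vk]; case: vu; rewrite vk.
Qed.

Lemma in_ell2_iapp_Q z : in_ell2 z -> in_ell2 (iapp Q z).
Proof.
move=> z2; have Q2 v c : 0 <= 2 * Q v c ^+ 2 by rewrite mulr_ge0 ?sqr_ge0.
have Qz2 v c : 0 <= 2 * Q v c ^+ 2 * z c ^+ 2.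
  by apply: mulr_ge0 => //; exact: sqr_ge0.
(* The factor 2 comes from [(x + y)^2 <= 2 x^2 + 2 y^2] on the at most two nonzero entries of a row;
   the columns have norm 1, so those of the kernel sum to 2. *)
apply: (@in_ell2_dominated _ _ _ (fun v c => 2 * Q v c ^+ 2) 2 z) => //.
- apply: X1_caseP => [a|a|v Xv].
  + apply: le_trans (le_sum_esum (s := [:: inl a; inr (cell_of (val a))]) _ _) => //.
    rewrite big_cons big_seq1 lee_fin iapp_Q_val Q_val (QrE_twins (a := a))// !eqxx.
    rewrite !mulr1 exprMn !expr2 sqrt2V_sqr; set x := z (inl a); set y := z _.
    by have := sqr_ge0 (x - y); nra.
  + apply: le_trans (le_sum_esum (s := [:: inl a; inr (cell_of (val a))]) _ _) => //.
    rewrite big_cons big_seq1 lee_fin iapp_Q_twin Q_twin.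
    rewrite (QrE_twins (a := a)) ?cell_of_twin// !eqxx !mulr1 sqrrN exprMn !expr2 sqrt2V_sqr; set x := z (inl a); set y := z _.
    by have := sqr_ge0 (x + y); nra.
  + apply: le_trans (le_sum_esum (s := [:: inr (cell_of v)]) _ _) => //.
    rewrite big_seq1 lee_fin iapp_Q_out// QrE eqxx mulr1 exprMn.
    by rewrite ler_wpM2r ?sqr_ge0//; have := sqr_ge0 (Num.sqrt (n (cell_of v)))^-1; lra.
- move=> [a|j].
  + rewrite (@esum_seq _ _ [:: val a; s (val a)])//.
    * rewrite big_cons big_seq1 Q_val Q_twin !eqxx !mulr1 sqrrN expr2 sqrt2V_sqr.
      by rewrite lee_fin; lra.
    * by rewrite /= inE val_neq_twin.
    * move=> v; rewrite !inE => /norP[/negbTE va /negbTE vsa].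
      by rewrite QlE va vsa subrr mulr0 expr0n mulr0.
  + rewrite (@esum_seq _ _ (fset_set (Pi j)))//.
    * rewrite -fsbig_finite; last exact: finite_cell.
      rewrite (sum_cell_const (c := 2 * (n j)^-1)) => [|v /cell_ofE vj].
        by rewrite mulrCA divff ?mulr1// gt_eqF// cell_card_gt0.
      by rewrite QrE vj eqxx mulr1 expr2 sqrt_cardV_sqr.
    * move=> v; rewrite in_fset_set; last exact: finite_cell.
      by rewrite in_cell QrE => /negbTE ->; rewrite mulr0 expr0n mulr0.
Qed.

Lemma sqr_sum_cell (z : V -> R) j :
  ((Num.sqrt (n j))^-1 * \sum_(v \in Pi j) z v) ^+ 2 <= \sum_(v \in Pi j) z v ^+ 2.
Proof.
have n0 := cell_card_gt0 j.
(* The variance of [z] on the cell is nonnegative. *)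
set S := \sum_(v \in Pi j) z v; pose m := S / n j.
have : 0 <= \sum_(v \in Pi j) (z v - m) ^+ 2 by apply: fsumr_ge0 => v _; exact: sqr_ge0.
have -> : \sum_(v \in Pi j) (z v - m) ^+ 2 =
    \sum_(v \in Pi j) z v ^+ 2 - 2 * m * S + n j * m ^+ 2.
  rewrite -(sum_cell_const (F := fun=> m ^+ 2) (k := j) (c := m ^+ 2))//.
  rewrite mulr_fsumr !fsbig_finite; try exact: finite_cell.
  by rewrite -sumrB -big_split/=; apply: eq_bigr => v _; ring.
have -> : ((Num.sqrt (n j))^-1 * S) ^+ 2 = (n j)^-1 * S ^+ 2.
  by rewrite exprMn expr2 sqrt_cardV_sqr.
have -> : 2 * m * S = 2 * ((n j)^-1 * S ^+ 2) by rewrite /m; ring.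
have -> : n j * m ^+ 2 = (n j)^-1 * S ^+ 2 by rewrite /m; field; rewrite gt_eqF.
lra.
Qed.

Lemma in_ell2_iapp_itr_Q z : in_ell2 z -> in_ell2 (iapp (itr Q) z).
Proof.
(* The kernel is the indicator of the support of [Q^T]. A vertex lies in one cell and in at most one
   twin pair, whence the constant 2. *)
pose k (c : X1 + J) (v : V) : R := match c with
  | inl a => ((v == val a) || (v == s (val a)))%:R
  | inr j => (cell_of v == j)%:R end.
have k0 c v : 0 <= k c v by case: c => c; rewrite /= ler0n.
have kz0 c (z' : V -> R) v : 0 <= k c v * z' v ^+ 2.
  by apply: mulr_ge0 => //; exact: sqr_ge0.
move=> z2; apply: (@in_ell2_dominated _ _ _ k 2 z) => //.
- move=> [a|j].
  + apply: le_trans (le_sum_esum (s := [:: val a; s (val a)]) _ _) => //; last first.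
      by rewrite /= inE val_neq_twin.
    rewrite big_cons big_seq1 lee_fin iapp_itr_Q_l /= !eqxx orbT !mul1r.
    rewrite exprMn expr2 sqrt2V_sqr; set x := z (val a); set y := z _.
    by have := sqr_ge0 (x + y); nra.
  + apply: le_trans (le_sum_esum (s := fset_set (Pi j)) _ _) => //.
    rewrite -fsbig_finite; last exact: finite_cell.
    rewrite lee_fin iapp_itr_Q_r; apply: le_trans (sqr_sum_cell _ _) _.
    rewrite !fsbig_finite; try exact: finite_cell.
    rewrite big_seq [leRHS]big_seq; apply: ler_sum => v.
    rewrite in_fset_set; last exact: finite_cell.
    by rewrite in_cell /= => ->; rewrite mul1r.
- apply: X1_caseP => [a|a|v Xv].
  + rewrite (@esum_seq _ _ [:: inl a; inr (cell_of (val a))])//.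
      by rewrite big_cons big_seq1 /= !eqxx.
    move=> [b|j] nin; apply/eqP; rewrite pnatr_eq0 eqb0; apply: contra nin.
      by rewrite val_neq_twin orbF => /eqP/val_inj ->; rewrite inE eqxx.
    by move=> /eqP <-; rewrite !inE eqxx orbT.
  + rewrite (@esum_seq _ _ [:: inl a; inr (cell_of (s (val a)))])//.
      by rewrite big_cons big_seq1 /= !eqxx orbT.
    move=> [b|j] nin; apply/eqP; rewrite pnatr_eq0 eqb0; apply: contra nin.
      rewrite eq_sym val_neq_twin /= (can_eq twin_autK) => /eqP/val_inj ->.
      by rewrite inE eqxx.
    by move=> /eqP <-; rewrite !inE eqxx orbT.
  + rewrite (@esum_seq _ _ [:: inr (cell_of v)])//.
      by rewrite big_seq1 /= eqxx lee_fin ler_nat.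
    move=> [b|j] nin; apply/eqP; rewrite pnatr_eq0 eqb0; apply: contra nin.
      case/orP => /eqP va; case: Xv; rewrite va; [left|right]; first exact: X1_val.
      exact/twin_autX/X1_val.
    by move=> /eqP <-; rewrite inE eqxx.
Qed.

(** * Equitable partitions give an invariant column space *)

Lemma bounded_degree : bounded_graph G -> exists2 M : R, 0 < M &
  forall a, (\esum_(b in [set: V]) `|w a b|%:E <= M%:E)%E.
Proof.
move=> [_ [M hM]]; exists (`|M| + 1) => [|a]; first by rewrite ltr_wpDl.
by apply: le_trans (hM a) _; rewrite lee_fin; have := ler_norm M; lra.
Qed.

Lemma in_ell2_iapp_A y : bounded_graph G -> in_ell2 y -> in_ell2 (iapp A y).
Proof.
move=> /bounded_degree[M M0 wM] y2.
(* Schur test: rows are handled by [isum_weight_sqr], columns by symmetry of the weights. *)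
apply: (@in_ell2_dominated _ _ _ (fun u v => M * `|w u v|) (M * M) y) => //.
- by move=> u v; rewrite mulr_ge0// ltW.
- by rewrite mulr_ge0 ?ltW.
- move=> u; set S := (X in (_ <= X)%E).
  have wy0 v : 0 <= `|w u v| * y v ^+ 2 by apply: mulr_ge0 => //; exact: sqr_ge0.
  have := isum_weight_sqr M0 (wM u) y2; rewrite -lee_fin => /le_trans; apply.
  rewrite EFinM fineK; last exact: esum_fin_num wy0 (summable_weight_sqr M0 (wM u) y2).
  (* [esumZ_le] bounds a scaled sum from above only; using it with the factor [M^-1] yields the
     opposite inequality for [M]. *)
  have -> : (\esum_(v in [set: V]) (`|w u v| * y v ^+ 2)%:E =
      \esum_(v in [set: V]) (M^-1 * (M * `|w u v| * y v ^+ 2))%:E)%E.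
    by apply: eq_esum => v _; rewrite -mulrA mulKf// gt_eqF.
  apply: le_trans (_ : M%:E * (M^-1%:E * S) <= _)%E.
    apply: lee_wpmul2l; first by rewrite lee_fin ltW.
    apply: esumZ_le => [|v]; first by rewrite invr_ge0 ltW.
    by rewrite -mulrA; apply: mulr_ge0; [exact: ltW|exact: wy0].
  by rewrite muleA -EFinM divff ?mul1e// gt_eqF.
- move=> v; apply: le_trans (esumZ_le (ltW M0) _) _ => //.
  rewrite EFinM; apply: lee_wpmul2l; first by rewrite lee_fin ltW.
  by under eq_esum => u _ do rewrite weight_sym.
Qed.

(** The difference of rows [u] and [v], multiplied by [y], sums to zero on every cell. On a twin
    pair, [u] and [v] each give both members the same weight, so equal degrees force equal weights;
    on any other cell [y] is constant and factors out. *)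
Lemma iapp_A_cell (y : V -> R) : bounded_graph G -> equitable G Pi -> in_ell2 y ->
    (forall u v, cell_of u = cell_of v -> ~ (X1 `|` X2) u -> y u = y v) ->
  forall u v, cell_of u = cell_of v -> ~ (X1 `|` X2) u -> iapp A y u = iapp A y v.
Proof.
move=> bG /equitableP eqG y2 yc u v uv Xu; have Xv := same_cell_out uv Xu.
have [M M0 wM] := bounded_degree bG.
apply/eqP; rewrite -subr_eq0 /iapp.
rewrite -isumB; try exact: (summable_weight_mul M0 (wM _) y2).
apply/eqP; case: (fP) => -[cov triv _] fin.
apply: (isum_cells0 triv cov fin) => k; case: (cell_cases k) => [[a X1a ->]|Xk].
  have := eqG (cell_of a) u v uv; rewrite !sum_cell_twins// /adjmx.
  rewrite !weight_twin_out// => wa; have -> : w u a = w v a by lra.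
  lra.
have [b Pkb] := cell_nonempty k.
transitivity ((\sum_(c \in Pi k) w u c) * y b - (\sum_(c \in Pi k) w v c) * y b).
  rewrite !fsbig_finite; try exact: finite_cell.
  rewrite !mulr_suml -sumrB !big_seq; apply: eq_bigr => c.
  rewrite in_fset_set ?inE; last exact: finite_cell.
  by move=> Pkc; rewrite (yc c b) ?(cell_ofE Pkc) ?(cell_ofE Pkb)//; exact: Xk.
by rewrite (eqG k u v uv) subrr.
Qed.

Lemma equitable_invariant : bounded_graph G -> equitable G Pi ->
  invariant_under A (colspace Q).
Proof.
move=> bG eqG _ [z z2 ->]; have y2 := in_ell2_iapp_Q z2.
(* The coefficients are the inner products with the orthonormal columns. *)
exists (iapp (itr Q) (iapp A (iapp Q z))).
  exact/in_ell2_iapp_itr_Q/in_ell2_iapp_A.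
rewrite iapp_Q_itr_Q//; apply: iapp_A_cell => // u v uv Xu.
by rewrite !iapp_Q_out ?uv//; exact: same_cell_out Xu.
Qed.

(** * The factorization [A Q = Q B] *)

Lemma invariant_factor : invariant_under A (colspace Q) ->
  exists B, imul A Q = imul Q B.
Proof.
move=> inv; pose e (c : X1 + J) : X1 + J -> R := basis_vec c.
have Qe c : iapp Q (e c) = fun v => Q v c.
  apply/funext => v; rewrite /iapp (@isum_seq _ _ [:: c])//.
    by rewrite big_seq1 /e /basis_vec eqxx mulr1.
  by move=> d; rewrite inE /e /basis_vec => /negbTE ->; rewrite mulr0.
have e2 c : in_ell2 (e c).
  rewrite /in_ell2 (@esum_seq _ _ [:: c])//= ?ltry//.
  by move=> d; rewrite inE /e /basis_vec => /negbTE ->; rewrite normr0 expr0n.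
have h c : exists x, iapp A (fun v => Q v c) = iapp Q x.
  have [|x _ xE] := inv (fun v => Q v c); last by exists x.
  by exists (e c) => //; rewrite Qe.
have [g gE] := choice h.
exists (fun d c => g c d); apply/funext => v; apply/funext => c.
by rewrite -[LHS]/(iapp A (fun v => Q v c) v) gE.
Qed.

Lemma factor_equitable B : imul A Q = imul Q B -> equitable G Pi.
Proof.
move=> AB; apply: equitable_outP => k u v uv Xu Xv.
(* Entry [(x, k)] of [A Q] is a scaled degree of [x], while that of [Q B] depends on [x] only
   through its cell. *)
have h x : ~ (X1 `|` X2) x -> (Num.sqrt (n k))^-1 * \sum_(b \in Pi k) w x b =
    (Num.sqrt (n (cell_of x)))^-1 * B (inr (cell_of x)) (inr k).
  move=> Xx; have := congr1 (fun C => C x (inr k)) AB.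
  rewrite imul_QE iapp_itr_Q_r => ->.
  by rewrite -[LHS]/(iapp Q (fun d => B d (inr k)) x) iapp_Q_out.
have n0 : (Num.sqrt (n k))^-1 != 0.
  by rewrite invr_eq0 gt_eqF// sqrtr_gt0 cell_card_gt0.
by apply: (mulfI n0); rewrite !h// uv.
Qed.

(** * Commutation with [Q Q^T] *)

Lemma imul_projE u v : imul A (imul Q (itr Q)) u v =
  if v \in X1 `|` X2 then w u v
  else (n (cell_of v))^-1 * \sum_(b \in Pi (cell_of v)) w u b.
Proof.
(* Column [v] of [Q Q^T] is a basis vector if [v] is a twin, and otherwise the uniform average on
   the cell of [v]. *)
rewrite imul_Q_itr_QE /imul /id_oplus_avg_mx; case: ifPn => [/set_mem Xv|/negP Xv].
  rewrite (@isum_seq _ _ [:: v])// => [|b].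
    by rewrite big_seq1 mem_set// eqxx mulr1.
  rewrite inE => bv; case: ifPn => [_|/negP Xb]; first by rewrite (negbTE bv) mulr0.
  rewrite (_ : [set k | _] = set0) ?fsbig_set0 ?mulr0//.
  apply/seteqP; split=> // k [/cell_ofE bk /cell_ofE vk].
  by apply: (@same_cell_out b v _ _ Xv); rewrite ?bk// => Xb'; apply: Xb; exact: mem_set.
have {}Xv : ~ (X1 `|` X2) v by move=> Xv'; apply: Xv; exact: mem_set.
rewrite (@isum_seq _ _ (fset_set (Pi (cell_of v)))).
- rewrite fsbig_finite ?mulr_sumr; last exact: finite_cell.
  rewrite !big_seq; apply: eq_bigr => b.
  rewrite in_fset_set ?in_cell; last exact: finite_cell.
  move=> /eqP bv; rewrite memNset; last by apply: same_cell_out Xv; rewrite bv.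
  rewrite (_ : [set k | _] = [set cell_of v]) ?fsbig_set1 1?mulrC//.
  apply/seteqP; split=> [k [_ /cell_ofE <-]//|_ ->] /=.
  by split; [rewrite -bv|]; exact: cell_ofP.
- exact: fset_uniq.
- move=> b; rewrite in_fset_set ?in_cell; last exact: finite_cell.
  move=> /eqP bv; case: ifPn => [/set_mem Xb|_].
    by case: eqP => [e|]; [case: bv; rewrite e|rewrite mulr0].
  rewrite (_ : [set k | _] = set0) ?fsbig_set0 ?mulr0//.
  by apply/seteqP; split=> // k [/cell_ofE bk /cell_ofE vk]; case: bv; rewrite bk.
Qed.

(** Both factors are symmetric, so the two products are transposes of each other and commutation
    means that [A Q Q^T] is symmetric. *)
Lemma imul_projC u v :
  imul (imul Q (itr Q)) A u v = imul A (imul Q (itr Q)) v u.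
Proof.
rewrite /imul; congr isum; apply/funext => b; rewrite mulrC /adjmx weight_sym.
by congr (_ * isum _); apply/funext => c; rewrite /itr mulrC.
Qed.

Lemma equitable_balance u v : equitable G Pi ->
  n (cell_of u) * \sum_(b \in Pi (cell_of v)) w u b =
  n (cell_of v) * \sum_(b \in Pi (cell_of u)) w v b.
Proof.
move=> /equitableP eqG.
have sumE x k : n (cell_of x) * \sum_(b \in Pi k) w x b =
    \sum_(y \in Pi (cell_of x)) \sum_(b \in Pi k) w y b.
  by apply/esym/sum_cell_const => y /cell_ofE; exact: eqG.
by rewrite !sumE exchange_degree.
Qed.

Lemma commute_equitableP :
  imul A (imul Q (itr Q)) = imul (imul Q (itr Q)) A <-> equitable G Pi.
Proof.
have memX v : reflect ((X1 `|` X2) v) (v \in X1 `|` X2).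
  by apply: (iffP idP) => [/set_mem|/mem_set].
split=> [com|eqG].
  have {}com u v : imul A (imul Q (itr Q)) u v = imul A (imul Q (itr Q)) v u.
    by rewrite -imul_projC com.
  apply: equitable_outP => k u v uv Xu Xv.
  case: (cell_cases k) => [[a X1a ->]|Xk].
    (* Symmetry at [(x, a)] equates one weight with an average over the cell of [x], hence with a
       quantity that depends only on that cell. *)
    have wa x : ~ (X1 `|` X2) x -> w x a =
        (n (cell_of x))^-1 * \sum_(b \in Pi (cell_of x)) w a b.
      move=> Xx; have := com x a; rewrite !imul_projE.
      by rewrite mem_set; [rewrite memNset|left].
    by rewrite !sum_cell_twins// !weight_twin_out// !wa// uv.
  have [c Pkc] := cell_nonempty k; have kc := cell_ofE Pkc.
  have dc x : ~ (X1 `|` X2) x -> (n k)^-1 * \sum_(b \in Pi k) w x b =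
      (n (cell_of x))^-1 * \sum_(b \in Pi (cell_of x)) w c b.
    by move=> Xx; have := com x c; rewrite !imul_projE !memNset ?kc//; exact: Xk.
  have n0 : (n k)^-1 != 0 by rewrite invr_eq0 gt_eqF// cell_card_gt0.
  by apply: (mulfI n0); rewrite !dc// uv.
apply/funext => u; apply/funext => v; rewrite imul_projC !imul_projE.
(* The degree of a vertex outside the twins into the pair of [y] is twice its weight to [y], so by
   equitability that weight is constant on the cell of [x] and equals its average. *)
have mixed x y : ~ (X1 `|` X2) x -> (X1 `|` X2) y ->
    (n (cell_of x))^-1 * \sum_(b \in Pi (cell_of x)) w y b = w x y.
  move=> Xx Xy; rewrite (sum_cell_const (c := w x y)).
    by rewrite mulKf// gt_eqF// cell_card_gt0.
  move=> b /cell_ofE bx; have Xb : ~ (X1 `|` X2) b.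
    by apply: same_cell_out Xx; rewrite bx.
  have : exists2 a, X1 a & forall z, ~ (X1 `|` X2) z -> w z y = w z a.
    case: (twins_cases y) => [X1y|[a X1a ->]|//]; first by exists y.
    by exists a => // z; exact: weight_twin_out.
  move=> [a X1a ya]; rewrite weight_sym !ya//.
  have := equitableP.1 eqG (cell_of a) b x bx.
  rewrite !sum_cell_twins// !weight_twin_out//; lra.
case: (memX u) => Xu; case: (memX v) => Xv.
- by rewrite weight_sym.
- by rewrite mixed// weight_sym.
- by rewrite mixed.
have nu := cell_card_gt0 (cell_of u); have nv := cell_card_gt0 (cell_of v).
apply: (mulfI (lt0r_neq0 nu)); rewrite mulrCA (equitable_balance _ _ eqG).
by rewrite mulKf ?lt0r_neq0// mulVKf ?lt0r_neq0.
Qed.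

(** * The blocks of [B] *)

Lemma factor_itr_Q B : imul A Q = imul Q B ->
  forall c d, B c d = iapp (itr Q) (fun x => iapp (itr Q) (A x) d) c.
Proof.
move=> AB c d.
have -> : (fun x => iapp (itr Q) (A x) d) = iapp Q (fun c => B c d).
  by apply/funext => x; rewrite -imul_QE AB.
by rewrite itr_Q_iapp_Q.
Qed.

(** Here [p], [q] are the sizes of two cells and [c], [d] the degrees between them. The balance
    relation gives [d = p c / q], so [c d] is the square of [t = sqrt (p / q) c], which has the sign
    of [c]. *)
Lemma quotient_entry (p q c d : R) : 0 < p -> 0 < q -> p * c = q * d ->
  (Num.sqrt p)^-1 * (p * ((Num.sqrt q)^-1 * c)) =
  if 0 <= c then Num.sqrt (c * d) else - Num.sqrt (c * d).
Proof.
move=> p0 q0 pq; pose t := Num.sqrt p / Num.sqrt q * c.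
have sp0 : 0 < Num.sqrt p by rewrite sqrtr_gt0.
have sq0 : 0 < Num.sqrt q by rewrite sqrtr_gt0.
have -> : c * d = t ^+ 2.
  rewrite /t !exprMn exprVn !sqr_sqrtr ?ltW//.
  have -> : d = p * c / q by rewrite pq; field; rewrite gt_eqF.
  by field; rewrite gt_eqF.
have -> : (Num.sqrt p)^-1 * (p * ((Num.sqrt q)^-1 * c)) = t.
  rewrite -{2}(sqr_sqrtr (ltW p0)) /t; field; rewrite !gt_eqF//.
rewrite sqrtr_sqr; case: ifPn => c0.
  by rewrite ger0_norm// mulr_ge0// divr_ge0// ltW.
rewrite ler0_norm ?opprK// /t mulr_ge0_le0 ?divr_ge0 ?ltW//.
by rewrite ltNge.
Qed.

Lemma factor_block B : imul A Q = imul Q B ->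
  B = block_imx (fun u v => adjmx (induced G X1) u v - cross_mx G f u v)
        (fun _ _ => 0) (fun _ _ => 0) (quotient_mx G Pi).
Proof.
move=> AB; have eqG := factor_equitable AB.
apply/funext => c; apply/funext => d; rewrite (factor_itr_Q AB).
case: c d => [a|j] [b|k] /=.
(* Of the four weights between two twin pairs, the automorphism identifies the two parallel ones and
   the two crossed ones, which cancels the factor 1/2. *)
- rewrite iapp_itr_Q_l !iapp_itr_Q_l /adjmx weight_twin_aut.
  have -> : w (s (val a)) (val b) = w (val a) (s (val b)).
    by rewrite -weight_twin_aut twin_autK.
  rewrite -mulrBr mulrA sqrt2V_sqr /cross_mx -(twin_autL (X1_val b)); lra.
- by rewrite iapp_itr_Q_l !iapp_itr_Q_r /adjmx degree_twin subrr mulr0.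
- rewrite iapp_itr_Q_r.
  under eq_fsbigr do rewrite iapp_itr_Q_l.
  rewrite -mulr_fsumr -[X in _ * (_ * X)]/(\sum_(v \in Pi j) (w v (val b) - w v (s (val b)))).
  rewrite fsbig_finite ?sumrB -?fsbig_finite; try exact: finite_cell.
  (* The automorphism permutes the cell and carries one sum to the other, so the lower left block
     vanishes. *)
  rewrite -[X in _ - X]sum_cell_twin_aut.
  under [X in _ - X]eq_fsbigr do rewrite weight_twin_aut.
  by rewrite subrr !mulr0.
- rewrite iapp_itr_Q_r; under eq_fsbigr do rewrite iapp_itr_Q_r.
  have [u Pju] := cell_nonempty j; have [v Pkv] := cell_nonempty k.
  have eqD := (equitableP.1 eqG).
  rewrite (sum_cell_const
    (c := (Num.sqrt (n k))^-1 * \sum_(x \in Pi k) w u x)); last first.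
    by move=> x Pjx; congr (_ * _); apply: eqD; rewrite (cell_ofE Pju) (cell_ofE Pjx).
  rewrite /quotient_mx -(cell_ofE Pju) -(cell_ofE Pkv) !quotient_coefE//.
  apply: quotient_entry; try exact: cell_card_gt0.
  exact: equitable_balance.
Qed.

End Cells.
End Twins.

Theorem theorem2p1 (R : realType) (V : countType) (G : wgraph R V)
    (X1 X2 : set V) (f : V -> V) (J : choiceType) (Pi : J -> set V)
    (A := adjmx G) (Q := Q_mx X1 X2 f Pi : V -> X1 + J -> R) :
  bounded_graph G ->
  edge_perturbed_twins G X1 X2 f ->
  finite_cell_partition Pi ->
  (forall a, X1 a -> exists j, Pi j = [set a; twin_aut X1 X2 f a]) ->
  [/\ [<-> equitable G Pi;
           invariant_under A (colspace Q);
           exists B : X1 + J -> X1 + J -> R, imul A Q = imul Q B;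
           imul A (imul Q (itr Q)) = imul (imul Q (itr Q)) A],
      imul Q (itr Q) = id_oplus_avg_mx Pi (X1 `|` X2) &
      forall B : X1 + J -> X1 + J -> R, imul A Q = imul Q B ->
        B = block_imx
              (fun u v => adjmx (induced G X1) u v - cross_mx G f u v)
              (fun _ _ => 0)
              (fun _ _ => 0)
              (quotient_mx G Pi)].
Proof.
move=> bG tw fP pairs; split.
- split; first exact: (equitable_invariant tw fP pairs).
  split; first exact: invariant_factor.
  split; last exact: (commute_equitableP tw fP pairs).1.
  (* Condition (3) reaches (4) through equitability. *)
  by move=> [B AB]; apply: (commute_equitableP tw fP pairs).2;
    exact: (factor_equitable tw fP pairs AB).
- exact: (imul_Q_itr_QE tw fP pairs).
- by move=> B; exact: (factor_block tw fP pairs).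
Qed.
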